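(* Let $A,B\in\mathbb{C}^{n\times n}$ be two matrices with identical eigenvalues (including algebraic multiplicities), and let their $K$ distinct eigenvalues be sorted as $\lambda_1\ge_{\mathrm{lex}}\lambda_2\ge_{\mathrm{lex}}\cdots\ge_{\mathrm{lex}}\lambda_K$. For each $i$, let $m_i(A)$ and $m_i(B)$ denote the Jordan block size partitions of the eigenvalue $\lambda_i$ for $A$ and $B$, respectively. Then the following statements are equivalent: 1. $[m_1(A),\dots,m_K(A)]\preceq_{\mathrm N}[m_1(B),\dots,m_K(B)]$. 2. There exists $k\in\{1,2,\dots,K\}$ such that for all $\ell\ge 0$ and all $j<k$, $$\mathrm{rank}\big((A-\lambda_jI)^\ell\big)=\mathrm{rank}\big((B-\lambda_jI)^\ell\big),$$ and, for the eigenvalue $\lambda_k$ and all $\ell\ge0$, $$\mathrm{rank}\big((A-\lambda_kI)^\ell\big)\le\mathrm{rank}\big((B-\lambda_kI)^\ell\big).$$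
   Context: Lexicographic order on $\mathbb{C}$: $\alpha\le_{\mathrm{lex}}\beta$ iff $\Re(\alpha)<\Re(\beta)$, or $\Re(\alpha)=\Re(\beta)$ and $\Im(\alpha)\le\Im(\beta)$; $\alpha\ge_{\mathrm{lex}}\beta$ means $\beta\le_{\mathrm{lex}}\alpha$. The Jordan block size partition $m_i(X)$ of a matrix $X$ at $\lambda_i$ is the list, in non-increasing order, of the sizes of the Jordan blocks of $X$ with eigenvalue $\lambda_i$; its entries sum to the algebraic multiplicity of $\lambda_i$. Dominance order: for partitions $p=(p_1\ge p_2\ge\cdots>0)$ and $q=(q_1\ge q_2\ge\cdots>0)$, $p\trianglelefteq q$ means $\sum_{i=1}^{j}p_i\le\sum_{i=1}^{j}q_i$ for all $j\ge1$, parts beyond the length of a partition being treated as $0$. Nilpotent order: $[m_1(A),\dots,m_K(A)]\preceq_{\mathrm N}[m_1(B),\dots,m_K(B)]$ iff there is some $k\in\{1,\dots,K\}$ such that $m_j(A)=m_j(B)$ for all $j<k$ and $m_k(A)\trianglelefteq m_k(B)$. *)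

(* Defs.v *)
From HB Require Import structures.
From mathcomp Require Import all_boot all_order all_algebra.
From mathcomp Require Import boolp classical_sets reals.
From mathcomp Require Import complex.

Set Implicit Arguments.
Unset Strict Implicit.
Unset Printing Implicit Defensive.

Import Order.TTheory GRing.Theory Num.Theory.

Local Open Scope ring_scope.
Local Open Scope complex_scope.

Definition lex_le (R : realType) (a b : R[i]) : bool :=
  (complex.Re a < complex.Re b) ||
  ((complex.Re a == complex.Re b) && (complex.Im a <= complex.Im b)).

Definition lex_ge (R : realType) (a b : R[i]) : bool := lex_le b a.

Definition jordan_block (F : fieldType) (a : F) (m : nat) : 'M[F]_m :=
  \matrix_(i, j) (if i == j then a else if i.+1 == j :> nat then 1 else 0).

(* An entry (a, m) of s stands for a Jordan block of size m with eigenvalue a. *)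
Definition jordan_mx (F : fieldType) (s : seq (F * nat)) :
    'M[F]_(\sum_(i < size s) (tnth (in_tuple s) i).2) :=
  \mxdiag_(i < size s)
    jordan_block (tnth (in_tuple s) i).1 (tnth (in_tuple s) i).2.

(* The dimension of jordan_mx s is not syntactically n, so invertibility of P is
   expressed by a two-sided inverse Q, which forces the dimensions to agree. *)
Definition is_jordan_form (F : fieldType) (n : nat) (X : 'M[F]_n)
    (s : seq (F * nat)) : Prop :=
  all (fun b => 0 < b.2)%N s /\
  exists P Q, [/\ P *m Q = 1%:M, Q *m P = 1%:M & X = P *m jordan_mx s *m Q].

(* The Jordan form X = P J P^-1 is unique only up to the order of the blocks; one is chosen,
   and the sorting below makes the choice irrelevant. Over an algebraically
   closed field a Jordan form always exists, so the default [::] is not used. *)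
Definition jordan_form (F : fieldType) (n : nat) (X : 'M[F]_n) :
    seq (F * nat) :=
  xget [::] [set s | is_jordan_form X s]%classic.

Definition jordan_partition (F : fieldType) (n : nat) (X : 'M[F]_n) (a : F) :
    seq nat :=
  sort geq [seq b.2 | b <- jordan_form X & b.1 == a].

Definition dominance (p q : seq nat) : Prop :=
  forall j : nat,
    (\sum_(0 <= i < j) nth 0 p i <= \sum_(0 <= i < j) nth 0 q i)%N.

Definition nilpotent_le (K : nat) (p q : 'I_K -> seq nat) : Prop :=
  exists k : 'I_K,
    (forall j : 'I_K, (j < k)%N -> p j = q j) /\ dominance (p k) (q k).

(* Main.v *)
Require Import Defs.
From HB Require Import structures.
From mathcomp Require Import all_boot all_order all_algebra.
From mathcomp Require Import perm.
From mathcomp Require Import boolp classical_sets reals.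
From mathcomp Require Import complex.

Set Implicit Arguments.
Unset Strict Implicit.
Unset Printing Implicit Defensive.

Import Order.TTheory GRing.Theory Num.Theory.

Local Open Scope ring_scope.
Local Open Scope complex_scope.

(* Write p for the Jordan partition of X at a. The power (X - a)^l lowers the
   rank of a Jordan block of size m by min(m, l) if its eigenvalue is a, and is
   invertible on the other blocks, so

     rank (X - a)^l + (multiplicity of a) = n + sum_(x in p) max(x - l, 0).

   The ranks therefore compare as the excess sums do, and two partitions
   satisfy p <= q in dominance order iff the excess sums of p are at most those
   of q for every l. The excess sums also determine the partition.

   For the existence of the Jordan form, let m be the first index at which the
   ranks of the powers of N = X - a stabilise. There are a row u with u N^m = 0
   and a column f with N^m f = 0 and u N^(m-1) f <> 0. The rows u N^i (i < m)
   span a Jordan block, and the common kernel of the columns N^j f (j < m) is an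
   invariant complement: the Hankel matrix of the u N^(i+j) f is
   anti-triangular, hence invertible. *)

(** * Similarity of matrices whose dimensions need not agree syntactically *)

Lemma mulmx1_dim (F : fieldType) n m (P : 'M[F]_(n, m)) (Q : 'M_(m, n)) :
  P *m Q = 1%:M -> Q *m P = 1%:M -> n = m.
Proof.
move=> PQ QP; apply/eqP; rewrite eqn_leq; apply/andP; split.
- rewrite -{1}(mxrank1 F n) -PQ.
  exact: leq_trans (mxrankM_maxl _ _) (rank_leq_col _).
- rewrite -{1}(mxrank1 F m) -QP.
  exact: leq_trans (mxrankM_maxl _ _) (rank_leq_col _).
Qed.

(* [is_jordan_form X s] is positivity of the block sizes together with
   [mxsim X (jordan_mx s)]. *)
Definition mxsim (F : fieldType) n m (X : 'M[F]_n) (Y : 'M[F]_m) : Prop :=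
  exists P Q, [/\ P *m Q = 1%:M, Q *m P = 1%:M & X = P *m Y *m Q].

Lemma mxsim_refl (F : fieldType) n (X : 'M[F]_n) : mxsim X X.
Proof. by exists 1%:M, 1%:M; rewrite !mulmx1 mul1mx. Qed.

Lemma mxsim_sym (F : fieldType) n m (X : 'M[F]_n) (Y : 'M_m) :
  mxsim X Y -> mxsim Y X.
Proof.
case=> P [Q [PQ QP ->]]; exists Q, P; split=> //.
by rewrite -!mulmxA QP mulmx1 mulmxA QP mul1mx.
Qed.

Lemma mxsim_trans (F : fieldType) n m p (X : 'M[F]_n) (Y : 'M_m) (Z : 'M_p) :
  mxsim X Y -> mxsim Y Z -> mxsim X Z.
Proof.
case=> P [Q [PQ QP ->]] [P' [Q' [PQ' QP' ->]]].
exists (P *m P'), (Q' *m Q); split; last by rewrite !mulmxA.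
- by rewrite mulmxA -(mulmxA P) PQ' mulmx1.
- by rewrite mulmxA -(mulmxA Q') QP mulmx1.
Qed.

Lemma mxsim_diag_block (F : fieldType) n m p (X : 'M[F]_p) (Y : 'M[F]_n)
    (Z : 'M_m) :
  mxsim Y Z -> mxsim (block_mx X 0 0 Y) (block_mx X 0 0 Z).
Proof.
case=> P [Q [PQ QP ->]].
exists (block_mx 1%:M 0 0 P), (block_mx 1%:M 0 0 Q).
rewrite !mulmx_block !(mul0mx, mulmx0, mul1mx, mulmx1, addr0, add0r) PQ QP.
by rewrite -!scalar_mx_block.
Qed.

Lemma mxsim_cast (F : fieldType) n m (e : n = m) (X : 'M[F]_n) :
  mxsim (castmx (e, e) X) X.
Proof. by subst m; rewrite castmx_id; exact: mxsim_refl. Qed.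

Lemma mxsim_exp (F : fieldType) n m (X : 'M[F]_n) (Y : 'M_m) (a : F) l :
  mxsim X Y -> mxsim ((X - a%:M) ^+ l) ((Y - a%:M) ^+ l).
Proof.
case=> P [Q [PQ QP ->]]; exists P, Q; split=> //.
have -> : P *m Y *m Q - a%:M = P *m (Y - a%:M) *m Q.
  by rewrite mulmxBr mulmxBl mul_mx_scalar -scalemxAl PQ scalemx1.
elim: l => [|l IH]; first by rewrite !expr0 mulmx1 PQ.
rewrite exprS IH [in RHS]exprS -![_ * _]/(_ *m _).
by rewrite !mulmxA -(mulmxA _ Q P) QP mulmx1.
Qed.

Lemma mxsim_rank (F : fieldType) n m (X : 'M[F]_n) (Y : 'M_m) :
  mxsim X Y -> \rank X = \rank Y.
Proof.
move=> XY; apply/eqP; rewrite eqn_leq; apply/andP; split.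
  case: XY => P [Q [_ _ ->]].
  exact: leq_trans (mxrankM_maxl _ _) (mxrankM_maxr _ _).
case: (mxsim_sym XY) => P [Q [_ _ ->]].
exact: leq_trans (mxrankM_maxl _ _) (mxrankM_maxr _ _).
Qed.

Lemma mxsim_char_poly (F : fieldType) n m (X : 'M[F]_n) (Y : 'M_m) :
  mxsim X Y -> char_poly X = char_poly Y.
Proof.
case=> P [Q [PQ QP ->]]; have e := mulmx1_dim PQ QP; subst m.
rewrite /char_poly /char_poly_mx.
set p := map_mx polyC P; set q := map_mx polyC Q.
have pq : p *m q = 1%:M by rewrite -map_mxM PQ map_mx1.
have -> : 'X%:M - map_mx polyC (P *m Y *m Q) =
    p *m ('X%:M - map_mx polyC Y) *m q.
  by rewrite !map_mxM mulmxBr mulmxBl mul_mx_scalar -scalemxAl pq scalemx1.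
by rewrite !det_mulmx mulrAC -det_mulmx pq det1 mul1r.
Qed.

Lemma char_poly_diag_block (F : fieldType) n m (X : 'M[F]_n) (Y : 'M_m) :
  char_poly (block_mx X 0 0 Y) = char_poly X * char_poly Y.
Proof.
rewrite /char_poly /char_poly_mx map_block_mx !map_mx0 (scalar_mx_block _ _ 'X).
by rewrite opp_block_mx add_block_mx !oppr0 !addr0 det_ublock.
Qed.

Lemma expr_diag_block (F : fieldType) n m (X : 'M[F]_n) (Y : 'M_m) (a : F) l :
  (block_mx X 0 0 Y - a%:M) ^+ l =
    block_mx ((X - a%:M) ^+ l) 0 0 ((Y - a%:M) ^+ l).
Proof.
rewrite scalar_mx_block opp_block_mx add_block_mx !oppr0 !addr0.
elim: l => [|l IH]; first by rewrite !expr0 -scalar_mx_block.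
rewrite !exprS IH -![_ * _]/(_ *m _) mulmx_block.
by rewrite !(mul0mx, mulmx0, addr0, add0r).
Qed.

(** * Ranks and characteristic polynomials of Jordan matrices *)

Lemma mxsim_mxdiag_cons (F : fieldType) k (f : 'I_k.+1 -> F * nat) :
  mxsim (\mxdiag_i jordan_block (f i).1 (f i).2)
    (block_mx (jordan_block (f ord0).1 (f ord0).2) 0 0
      (\mxdiag_i jordan_block (f (lift ord0 i)).1 (f (lift ord0 i)).2)).
Proof. by rewrite mxdiag_recl; apply: mxsim_cast. Qed.

Lemma jordan_mx_cons (F : fieldType) (b : F * nat) s :
  mxsim (jordan_mx (b :: s))
    (block_mx (jordan_block b.1 b.2) 0 0 (jordan_mx s)).
Proof.
(* The dimension depends on the family of blocks, so the tail family is replaced as a whole, through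
   an equality of functions. *)
have H (g : 'I_(size s) -> F * nat) :
    (fun i => tnth (in_tuple (b :: s)) (lift ord0 i)) = g ->
    mxsim (jordan_mx (b :: s)) (block_mx (jordan_block b.1 b.2) 0 0
      (\mxdiag_i jordan_block (g i).1 (g i).2)).
  by move=> <-; exact: mxsim_mxdiag_cons.
by apply: H; apply/funext => i; rewrite (tnth_nth b) [RHS](tnth_nth b).
Qed.

(** [i] is any natural number because shifted indices may leave the matrix; the sum then
    vanishes. *)
Lemma sum_shift (F : fieldType) m (g : nat -> F) i :
  \sum_(k < m) (i == k :> nat)%:R * g k = (i < m)%:R * g i.
Proof.
case: ltnP => im.
  rewrite (bigD1 (Ordinal im)) //= eqxx big1 ?addr0 // => k ki.
  case: eqP => [e|_]; last by rewrite mul0r.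
  by case/eqP: ki; apply: val_inj.
rewrite big1 ?mul0r // => k _; case: eqP => [e|_]; last by rewrite mul0r.
by move: im; rewrite e leqNgt ltn_ord.
Qed.

Definition shift_mx (F : fieldType) m : 'M[F]_m :=
  \matrix_(i, j) (i.+1 == j :> nat)%:R.

Lemma jordan_blockE (F : fieldType) (a : F) m :
  jordan_block a m = a%:M + shift_mx F m.
Proof.
apply/matrixP=> i j; rewrite !mxE -val_eqE /=.
case: eqVneq => [->|_]; first by rewrite gtn_eqF // addr0.
by rewrite mulr0n add0r; case: eqP.
Qed.

Lemma shift_mx_exp (F : fieldType) m l :
  shift_mx F m ^+ l = \matrix_(i, j) (i + l == j)%N%:R.
Proof.
elim: l => [|l IH].
  by apply/matrixP=> i j; rewrite expr0 !mxE addn0 val_eqE.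
rewrite exprS IH -[_ * _]/(_ *m _); apply/matrixP=> i j; rewrite !mxE.
under eq_bigr do rewrite !mxE.
rewrite (sum_shift m (fun k => (k + l == j)%N%:R)) addSnnS.
case: ltnP => h; rewrite ?mul1r ?mul0r //.
(* Here [m <= i.+1], so [i + l.+1] exceeds every column index and the right side is 0 as well. *)
rewrite gtn_eqF // (leq_trans (ltn_ord j)) // (leq_trans h) //.
by rewrite addnS ltnS leq_addr.
Qed.

(** With [S] the power and [P = pid_mx (m - l)], the identity [S = P *m S] bounds the rank from
    above and [S *m S^T = P] from below. *)
Lemma rank_shift_mx_exp (F : fieldType) m l :
  \rank (shift_mx F m ^+ l) = (m - l)%N.
Proof.
rewrite shift_mx_exp; set S := \matrix_(i, j) _.
have rankP : \rank (pid_mx (m - l) : 'M[F]_m) = (m - l)%N.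
  by rewrite rank_pid_mx // leq_subr.
apply/eqP; rewrite eqn_leq; apply/andP; split; rewrite -{1}rankP.
  suff -> : S = pid_mx (m - l) *m S by exact: mxrankM_maxl.
  apply/matrixP => i j; rewrite !mxE.
  under eq_bigr => k _ do rewrite !mxE -mulnb natrM -mulrA.
  rewrite (sum_shift m (fun k => (i < m - l)%N%:R * (k + l == j)%N%:R)).
  rewrite ltn_ord mul1r ltn_subRL addnC.
  by case: eqP => [->|_]; rewrite ?mulr0 // ltn_ord mul1r.
suff <- : S *m S^T = pid_mx (m - l) by exact: mxrankM_maxl.
apply/matrixP => i j; rewrite !mxE.
under eq_bigr do rewrite !mxE.
rewrite (sum_shift m (fun k => (j + l == k)%N%:R)) eqn_add2r ltn_subRL addnC.
by rewrite -natrM mulnb andbC eq_sym addnC.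
Qed.

Lemma rank_jordan_block (F : fieldType) (a b : F) m l :
  \rank ((jordan_block b m - a%:M) ^+ l) = (if b == a then m - l else m)%N.
Proof.
rewrite jordan_blockE; case: eqVneq => [->|ba].
  by rewrite addrAC subrr add0r rank_shift_mx_exp.
have -> : b%:M + shift_mx F m - a%:M = (b - a)%:M + shift_mx F m.
  by rewrite addrAC -raddfB.
(* [M] is upper triangular with diagonal entries [b - a]; [det_trig] wants a lower triangular
   matrix, hence the transpose. *)
set M := _ + _; have uM : M \in unitmx.
  rewrite -unitmx_tr unitmxE det_trig; last first.
    apply/is_trig_mxP => i j ij.
    by rewrite !mxE -val_eqE /= !gtn_eqF ?mulr0n ?addr0 // (ltn_trans ij).
  rewrite unitfE; apply/prodf_neq0 => i _.
  by rewrite !mxE eqxx gtn_eqF // addr0 subr_eq0.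
rewrite mxrank_unit //.
elim: l => [|l IH]; first by rewrite expr0 unitmx1.
by rewrite exprS -[_ * _]/(_ *m _) unitmx_mul uM.
Qed.

Lemma rank_jordan_mx (F : fieldType) (a : F) s l :
  \rank ((jordan_mx s - a%:M) ^+ l) =
    (\sum_(b <- s) if b.1 == a then b.2 - l else b.2)%N.
Proof.
elim: s => [|b s IH].
  rewrite big_nil; apply/eqP; rewrite -leqn0.
  by apply: leq_trans (rank_leq_row _) _; rewrite big_ord0.
rewrite (mxsim_rank (mxsim_exp a l (jordan_mx_cons b s))) expr_diag_block.
by rewrite rank_diag_block_mx rank_jordan_block IH big_cons.
Qed.

Lemma char_poly_jordan_block (F : fieldType) (a : F) m :
  char_poly (jordan_block a m) = ('X - a%:P) ^+ m.
Proof.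
have <- : char_poly (jordan_block a m)^T = char_poly (jordan_block a m).
  rewrite /char_poly -[RHS]det_tr /char_poly_mx linearB /= tr_scalar_mx.
  by rewrite map_trmx.
rewrite char_poly_trig; last first.
  apply/is_trig_mxP => i j ij.
  by rewrite !mxE -val_eqE /= !gtn_eqF // (ltn_trans ij).
under eq_bigr do rewrite !mxE eqxx.
by rewrite prodr_const card_ord.
Qed.

Lemma mup_jordan_mx (F : fieldType) (a : F) s :
  mup a (char_poly (jordan_mx s)) = (\sum_(b <- s | b.1 == a) b.2)%N.
Proof.
elim: s => [|b s IH].
  have e : (\sum_(i < size (Nil (F * nat)))
      (tnth (in_tuple [::]) i).2 = 0)%N by rewrite big_ord0.
  rewrite big_nil mupNroot //; apply/negP => /root_size_gt1.
  have /monic_neq0 -> := char_poly_monic (jordan_mx (Nil (F * nat))).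
  by move=> /(_ isT); rewrite size_char_poly ltnS [X in (_ <= X)%N -> _]e.
rewrite (mxsim_char_poly (jordan_mx_cons b s)) char_poly_diag_block.
rewrite mupM ?monic_neq0 ?char_poly_monic // IH big_cons.
by rewrite char_poly_jordan_block mup_XsubCX; case: ifP.
Qed.

(** * Existence of the Jordan form *)

Lemma col_mulmx (R : pzSemiRingType) m n p (A : 'M[R]_(m, n)) (B : 'M_(n, p))
    j :
  col j (A *m B) = A *m col j B.
Proof. by rewrite !colE mulmxA. Qed.

(** If every multiplication by [N] lowered the rank, [n + 1] of them would lower it below 0. *)
Lemma exists_rank_exp_stable (F : fieldType) n (N : 'M[F]_n) :
  exists m, \rank (N ^+ m) == \rank (N ^+ m.+1).
Proof.
apply: contrapT => /forallNP h.
have {}h k : (\rank (N ^+ k) + k <= n)%N.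
  elim: k => [|k IH]; first by rewrite addn0 rank_leq_row.
  apply: leq_trans IH; rewrite addnS ltn_add2r.
  have le : (\rank (N ^+ k.+1) <= \rank (N ^+ k))%N.
    by rewrite exprS; exact: mxrankM_maxr.
  by rewrite ltn_neqAle le andbT eq_sym; apply/negP/h.
by have := h n.+1; rewrite addnS ltnNge leq_addl.
Qed.

Lemma exists_jordan_chain (F : fieldType) n (X : 'M[F]_n) (a : F) :
  eigenvalue X a ->
  exists m (u : 'rV_n) (f : 'cV_n), let N := X - a%:M in
    [/\ u *m N ^+ m.+1 = 0, N ^+ m.+1 *m f = 0 & u *m N ^+ m *m f != 0].
Proof.
set N := X - a%:M => eigN.
case: (ex_minnP (exists_rank_exp_stable N)) => -[|m] /eqP stab minm.
  case/negP: eigN; rewrite kermx_eq0 /row_free -/N.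
  by rewrite -[N]expr1 -stab expr0 mxrank1.
have le k : (\rank (N ^+ k.+1) <= \rank (N ^+ k))%N.
  by rewrite exprS; exact: mxrankM_maxr.
have lt : (\rank (N ^+ m.+1) < \rank (N ^+ m))%N.
  rewrite ltn_neqAle le andbT eq_sym; apply/negP => /minm.
  by rewrite ltnn.
have kerS : (kermx (N ^+ m.+2) <= kermx (N ^+ m.+1))%MS.
  have sub : (kermx (N ^+ m.+1) <= kermx (N ^+ m.+2))%MS.
    apply/sub_kermxP; rewrite (exprSr _ m.+1) -[_ * _]/(_ *m _) mulmxA.
    by rewrite mulmx_ker mul0mx.
  by rewrite -(geq_leqif (mxrank_leqif_sup sub)) !mxrank_ker -stab.
have : ~~ (kermx (N ^+ m.+1) <= kermx (N ^+ m))%MS.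
  apply/negP => /mxrankS; rewrite !mxrank_ker leqNgt.
  by rewrite ltn_sub2l // (leq_trans lt) // rank_leq_row.
case/row_subPn => i; set u := row i _ => uNm.
have uN : u *m N ^+ m.+1 = 0 by rewrite -row_mul mulmx_ker row0.
(* If [u N^m = x N^(m+1)], then [x N^(m+2) = u N^(m+1) = 0], so [x N^(m+1) = 0] by [kerS],
   contradicting [u N^m <> 0]. *)
have : u *m N ^+ m *m cokermx (N ^+ m.+1) != 0.
  rewrite -submxE; apply/negP => /submxP [x ux].
  case/negP: uNm; apply/sub_kermxP; rewrite ux.
  apply/sub_kermxP/(submx_trans _ kerS)/sub_kermxP.
  rewrite (exprSr _ m.+1) -[_ * _]/(_ *m _) mulmxA -ux -mulmxA.
  by rewrite -[_ *m N]/(_ * _) -exprSr.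
case/rV0Pn => j uNf; exists m, u, (col j (cokermx (N ^+ m.+1))); split=> //.
  by rewrite -col_mulmx mulmx_coker col0.
apply: contraNneq uNf; rewrite -col_mulmx => /matrixP /(_ 0 0).
by rewrite !mxE => ->.
Qed.

Lemma hankel_unitmx (F : fieldType) m (h : nat -> F) :
  (forall k, (m < k)%N -> h k = 0) -> h m != 0 ->
  (\matrix_(i < m.+1, j < m.+1) h (i + j)%N) \in unitmx.
Proof.
move=> h0 hm; set H := \matrix_(i, j) _.
(* Reversing the order of the rows makes [H] lower triangular. *)
suff : row_perm (perm (@rev_ord_inj m.+1)) H \in unitmx.
  by rewrite row_permE unitmx_mul unitmx_perm.
rewrite unitmxE det_trig.
  rewrite unitfE; apply/prodf_neq0 => i _; rewrite !mxE permE /= subSS subnK //.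
  by rewrite -ltnS.
apply/is_trig_mxP => i j ij; rewrite !mxE permE /= subSS h0 //.
have im : (i <= m)%N by rewrite -ltnS.
by rewrite -{1}(subnK im) ltn_add2l.
Qed.

Lemma split_jordan_block (F : fieldType) n (X : 'M[F]_n) (a : F) :
  eigenvalue X a ->
  exists m r (Y : 'M_r), mxsim X (block_mx (jordan_block a m.+1) 0 0 Y).
Proof.
case/exists_jordan_chain => m [u [f /=]]; set N := X - a%:M => -[uN Nf uNf].
have XE : X = a%:M + N by rewrite /N addrC subrK.
have uN0 k : (m < k)%N -> u *m N ^+ k = 0.
  move=> mk; rewrite -(subnKC mk) exprD -[_ * _]/(_ *m _) mulmxA uN.
  by rewrite mul0mx.
pose C : 'M_(m.+1, n) := \matrix_(i, j) (u *m N ^+ i) 0 j.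
pose D : 'M_(n, m.+1) := \matrix_(i, j) (N ^+ j *m f) i 0.
have CX : C *m X = jordan_block a m.+1 *m C.
  rewrite XE jordan_blockE mulmxDr mulmxDl mul_mx_scalar mul_scalar_mx.
  congr (_ + _); apply/row_matrixP => i; rewrite !row_mul.
  have rowC k : row k C = u *m N ^+ k by apply/rowP => j; rewrite !mxE.
  rewrite rowC -mulmxA -[_ *m N]/(_ * _) -exprSr; apply/rowP => j.
  rewrite -row_mul [RHS]mxE [RHS]mxE.
  under eq_bigr do rewrite [shift_mx _ _ _ _]mxE [C _ _]mxE.
  rewrite (sum_shift m.+1 (fun k => (u *m N ^+ k) 0 j)) ltnS.
  by case: ltnP => [_|mi]; rewrite ?mul1r // mul0r uN0 // mxE.
(* [N] shifts the columns of [D], and the last one becomes [N^(m+1) f = 0]; hence the left kernel of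
   [D] is invariant under [X]. *)
have kerDX p (w : 'M_(p, n)) : w *m D = 0 -> w *m X *m D = 0.
  move=> wD; rewrite XE mulmxDr mulmxDl mul_mx_scalar -scalemxAl wD scaler0.
  rewrite add0r -mulmxA; apply/matrixP => i j.
  have colD k : col k D = N ^+ k *m f by apply/colP => ?; rewrite !mxE.
  have -> : (w *m (N *m D)) i j = (w *m (N ^+ j.+1 *m f)) i 0.
    rewrite exprS -[_ * _]/(_ *m _) -mulmxA -colD -!col_mulmx.
    by rewrite !mxE.
  case: (ltnP j.+1 m.+1) => jm; last first.
    have -> : j.+1 = m.+1 by apply/eqP; rewrite eqn_leq jm ltn_ord.
    by rewrite Nf mulmx0 !mxE.
  rewrite -(colD (Ordinal jm)) -col_mulmx wD.
  by rewrite !mxE.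
have uCD : C *m D \in unitmx.
  have -> : C *m D = \matrix_(i, j) (u *m N ^+ (i + j) *m f) 0 0.
    apply/matrixP => i j; rewrite [RHS]mxE exprD -[_ * _]/(_ *m _).
    rewrite mulmxA -(mulmxA (u *m _)) [LHS]mxE [RHS]mxE.
    by apply: eq_bigr => k _; rewrite [C _ _]mxE [D _ _]mxE.
  apply: (hankel_unitmx (h := fun k => (u *m N ^+ k *m f) 0 0)).
    by move=> k /uN0 ->; rewrite mul0mx mxE.
  apply: contraNneq uNf => e; apply/eqP/matrixP => i j.
  by rewrite !ord1 e mxE.
pose G := D *m invmx (C *m D).
have CG : C *m G = 1%:M by rewrite mulmxA mulmxV.
pose W := row_base (kermx D).
have WD : W *m D = 0 by apply/sub_kermxP; rewrite eq_row_base.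
have WG : W *m G = 0 by rewrite mulmxA WD mul0mx.
(* On row vectors, [e] is the projection onto the row space of [W] along that of [C]. *)
pose e := 1%:M - G *m C.
have Ce : C *m e = 0 by rewrite mulmxBr mulmx1 mulmxA CG mul1mx subrr.
have eW : (e <= W)%MS.
  rewrite eq_row_base; apply/sub_kermxP.
  by rewrite mulmxBl mul1mx -!mulmxA mulVmx // mulmx1 subrr.
have WX : (W *m X <= W)%MS.
  apply: (submx_trans (B := kermx D)); last by rewrite eq_row_base.
  exact/sub_kermxP/kerDX.
have pW : W *m pinvmx W = 1%:M by rewrite mulmxVp // row_base_free.
(* The new block is the action of [X] on the left kernel of [D] in the basis [W]; stacking [C] over
   [W] is the change of basis. *)
exists m, (\rank (kermx D)), (W *m X *m pinvmx W).
apply: mxsim_sym; exists (col_mx C W), (row_mx G (e *m pinvmx W)); split.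
- rewrite mul_col_row CG WG !(mulmxA _ e) Ce mul0mx mulmxBr mulmx1.
  by rewrite (mulmxA W) WG mul0mx subr0 pW -scalar_mx_block.
- by rewrite mul_row_col mulmxKpV // addrC subrK.
- have WXG : W *m X *m G = 0 by rewrite mulmxA kerDX // mul0mx.
  rewrite mul_col_mx mul_col_row CX WXG -(mulmxA _ C G) CG mulmx1.
  rewrite !(mulmxA _ e) (mulmxBr (W *m X)) mulmx1 (mulmxA _ G C) WXG mul0mx.
  by rewrite subr0 -(mulmxA _ C e) Ce mulmx0 mul0mx.
Qed.

(** Strong induction on the dimension: an eigenvalue exists in positive dimension, and splitting off
    a nonempty block leaves a smaller matrix. *)
Lemma jordan_form_exists (F : closedFieldType) n (X : 'M[F]_n) :
  exists s, is_jordan_form X s.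
Proof.
elim/ltn_ind: n X => -[|n] IH X.
  exists [::]; split=> //.
  exists (\matrix_(i, j) 0), (\matrix_(i, j) 0).
  have e : (\sum_(i < size (Nil (F * nat)))
      (tnth (in_tuple [::]) i).2 = 0)%N by rewrite big_ord0.
  split; apply/matrixP => -[i Hi] //.
  by exfalso; move: Hi; rewrite [X in (_ < X)%N]e.
have : size (char_poly X) != 1%N by rewrite size_char_poly.
case/closed_rootP => a; rewrite -eigenvalue_root_char.
case/split_jordan_block => m [r [Y XY]].
have rn : (r < n.+1)%N.
  case: XY => P [Q [PQ QP _]].
  by rewrite (mulmx1_dim PQ QP) addSn ltnS leq_addl.
have [s [spos sY]] := IH r rn Y.
exists ((a, m.+1) :: s); split=> //.
apply: mxsim_trans XY _; apply: mxsim_trans (mxsim_sym (jordan_mx_cons _ _)).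
exact: mxsim_diag_block.
Qed.

(** * Dominance order and excess sums *)

Lemma nonincreasing_nth (p : seq nat) i j :
  sorted geq p -> (i <= j)%N -> (nth 0 p j <= nth 0 p i)%N.
Proof.
move=> sp ij; have [jp|pj] := ltnP j (size p); last by rewrite nth_default.
have geq_trans : transitive geq by move=> x y z yx xz; exact: leq_trans xz yx.
by apply: (sorted_leq_nth geq_trans leqnn 0 sp) => //; exact: leq_ltn_trans jp.
Qed.

Lemma sum_excessE (p : seq nat) (l m : nat) : (size p <= m)%N ->
  (\sum_(x <- p) (x - l) = \sum_(0 <= i < m) (nth 0 p i - l))%N.
Proof.
move=> pm; rewrite (big_nth 0) (big_cat_nat (leq0n _) pm) //=.
rewrite [X in (_ + X)%N]big_nat.
by rewrite [X in (_ + X)%N]big1 ?addn0 // => i /andP[pi _]; rewrite nth_default.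
Qed.

(** Each part is at most [l] plus its truncated excess, and the excesses beyond index [j] only add
    to the right side. *)
Lemma prefix_sum_le (p : seq nat) (l j : nat) :
  (\sum_(0 <= i < j) nth 0 p i <= \sum_(x <- p) (x - l) + j * l)%N.
Proof.
rewrite (sum_excessE l (leq_addl j (size p))).
rewrite (big_cat_nat (leq0n j) (leq_addr _ j)) //=.
rewrite -addnA addnCA addnC (leq_trans _ (leq_addr _ _)) //.
rewrite -[X in (_ <= _ + X * _)%N]subn0 -sum_nat_const_nat -big_split /=.
by apply: leq_sum => i _; rewrite addnC -leq_subLR.
Qed.

(** The subtraction truncates nothing before index [j], and every excess from [j] on is 0. *)
Lemma prefix_sumE (p : seq nat) (l j : nat) :
  (forall i, (i < j)%N -> (l <= nth 0 p i)%N) ->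
  (forall i, (j <= i)%N -> (nth 0 p i <= l)%N) ->
  (\sum_(0 <= i < j) nth 0 p i = \sum_(x <- p) (x - l) + j * l)%N.
Proof.
move=> ge le.
rewrite (sum_excessE l (leq_addl j (size p))).
rewrite (big_cat_nat (leq0n j) (leq_addr _ j)) //=.
rewrite [X in (_ + X + _)%N]big_nat.
rewrite [X in (_ + X + _)%N]big1 => [|i /andP[ji _]].
  rewrite addn0 -[X in (_ + X * _)%N]subn0 -sum_nat_const_nat -big_split /=.
  by apply: eq_big_nat => i /andP[_ ij]; rewrite subnK ?ge.
by apply/eqP; rewrite subn_eq0 le.
Qed.

(* Both directions bound a prefix sum by [prefix_sum_le], which is an equality
   when the cutoff [l] separates the first [j] parts from the others: given [l],
   take for [j] the number of parts exceeding [l]; given [j], take [l] to be the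
   part of index [j] of [q]. *)
Lemma dominance_excess (p q : seq nat) : sorted geq p -> sorted geq q ->
  dominance p q <->
  forall l, (\sum_(x <- p) (x - l) <= \sum_(x <- q) (x - l))%N.
Proof.
move=> sp sq; split=> [dom l|le j]; last first.
  rewrite (prefix_sumE (p := q) (l := nth 0 q j)); last first.
  - by move=> i; exact: nonincreasing_nth.
  - by move=> i /ltnW; exact: nonincreasing_nth.
  by apply: leq_trans (prefix_sum_le p (nth 0 q j) j) _; rewrite leq_add2r le.
pose j := find (geq l) p.
rewrite -(leq_add2r (j * l)) -prefix_sumE.
- exact: leq_trans (dom j) (prefix_sum_le q l j).
- by move=> i /(before_find 0) /=; rewrite leqNgt => /negbFE /ltnW.
- move=> i /(nonincreasing_nth sp) /leq_trans; apply.
  have [h|h] := boolP (has (geq l) p); first exact: (nth_find 0 h).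
  (* When all parts exceed [l], [find] returns the size of [p], where [nth] gives 0. *)
  by rewrite nth_default // leqNgt -has_find.
Qed.

(** Dominance both ways makes all prefix sums, hence all entries, agree; positivity of the parts
    then forces equal lengths. *)
Lemma partition_excess_inj (p q : seq nat) : sorted geq p -> sorted geq q ->
  all (leq 1) p -> all (leq 1) q ->
  (forall l, \sum_(x <- p) (x - l) = \sum_(x <- q) (x - l))%N -> p = q.
Proof.
move=> sp sq p0 q0 e.
have pq : dominance p q by apply/dominance_excess => // l; rewrite e.
have qp : dominance q p by apply/dominance_excess => // l; rewrite e.
have eqS j : (\sum_(0 <= i < j) nth 0 p i = \sum_(0 <= i < j) nth 0 q i)%N.
  by apply/eqP; rewrite eqn_leq pq qp.
have eqn j : nth 0 p j = nth 0 q j.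
  by have := eqS j.+1; rewrite !big_nat_recr //= eqS => /addnI.
have size_le (r r' : seq nat) : all (leq 1) r ->
    (forall j, nth 0 r j = nth 0 r' j) -> (size r <= size r')%N.
  move=> r0 rr'; rewrite leqNgt; apply/negP => /(all_nthP 0 r0).
  by rewrite rr' nth_default.
apply: (@eq_from_nth _ 0) => //.
by apply/eqP; rewrite eqn_leq !size_le.
Qed.

(** * Ranks of powers in terms of Jordan partitions *)

Lemma jordan_formP (F : closedFieldType) n (X : 'M[F]_n) :
  is_jordan_form X (jordan_form X).
Proof. by have [s sX] := jordan_form_exists X; exact: (xgetI [::] sX). Qed.

Lemma jordan_partition_sorted (F : fieldType) n (X : 'M[F]_n) a :
  sorted geq (jordan_partition X a).
Proof. by apply: sort_sorted => x y; exact: leq_total. Qed.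

Lemma jordan_partition_gt0 (F : closedFieldType) n (X : 'M[F]_n) a :
  all (leq 1) (jordan_partition X a).
Proof.
rewrite all_sort all_map all_filter.
by apply: sub_all (jordan_formP X).1 => b /= b0; apply/implyP.
Qed.

Lemma big_jordan_partition (F : fieldType) n (X : 'M[F]_n) a (f : nat -> nat) :
  (\sum_(x <- jordan_partition X a) f x =
    \sum_(b <- jordan_form X | b.1 == a) f b.2)%N.
Proof.
by rewrite (perm_big _ (permEl (perm_sort _ _))) /= big_map big_filter.
Qed.

(** The multiplicity is added on the left to avoid a truncated subtraction. *)
Lemma rank_jordan_partition (F : closedFieldType) n (X : 'M[F]_n) a l :
  (\rank ((X - a%:M) ^+ l) + mup a (char_poly X) =
    n + \sum_(x <- jordan_partition X a) (x - l))%N.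
Proof.
have [_ XJ] := jordan_formP X.
have rankE k : \rank ((X - a%:M) ^+ k) =
    (\sum_(x <- jordan_partition X a) (x - k) +
      \sum_(b <- jordan_form X | b.1 != a) b.2)%N.
  rewrite (mxsim_rank (mxsim_exp a k XJ)) rank_jordan_mx.
  rewrite (bigID (fun b => b.1 == a)) /= (big_jordan_partition X a (subn^~ k)).
  congr (_ + _)%N; apply: eq_bigr => b; first by move=> ->.
  by move/negbTE=> ->.
(* At exponent 0 the formula writes [n] as the sum of all block sizes, which accounts for the blocks
   of other eigenvalues. *)
have := rankE 0; rewrite expr0 mxrank1 => nE.
rewrite (mxsim_char_poly XJ) mup_jordan_mx rankE [X in _ = (X + _)%N]nE.
rewrite (big_jordan_partition X a (subn^~ 0)) /=.
under [in RHS]eq_bigr do rewrite subn0.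
by rewrite addnC addnA addnAC.
Qed.

Theorem theorem3 (R : realType) (n : nat) (A B : 'M[R[i]]_n)
    (K : nat) (lam : K.-tuple R[i])
    (same_eigenvalues :
       forall z : R[i], mup z (char_poly A) = mup z (char_poly B))
    (lam_eigenvalues : forall z : R[i], (z \in lam) = eigenvalue A z)
    (lam_distinct : uniq lam)
    (lam_sorted : sorted (@lex_ge R) lam) :
  nilpotent_le (fun i : 'I_K => jordan_partition A (tnth lam i))
               (fun i : 'I_K => jordan_partition B (tnth lam i))
  <->
  exists k : 'I_K,
    (forall (l : nat) (j : 'I_K), (j < k)%N ->
       \rank ((A - (tnth lam j)%:M) ^+ l) = \rank ((B - (tnth lam j)%:M) ^+ l))
    /\
    (forall l : nat,
       (\rank ((A - (tnth lam k)%:M) ^+ l)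
          <= \rank ((B - (tnth lam k)%:M) ^+ l))%N).
Proof.
(* The lemma restated with the canonical structures that the statement
   elaborates for [R[i]], so that it can be rewritten with. *)
have rankE (X : 'M[R[i]]_n) (a : R[i]) l :
    (\rank ((X - a%:M) ^+ l) + mup a (char_poly X) =
      n + \sum_(x <- jordan_partition X a) (x - l))%N.
  exact: (rank_jordan_partition (F := R[i])).
have rank_le (X Y : 'M[R[i]]_n) (a : R[i]) l :
    mup a (char_poly X) = mup a (char_poly Y) ->
    (\rank ((X - a%:M) ^+ l) <= \rank ((Y - a%:M) ^+ l))%N =
    (\sum_(x <- jordan_partition X a) (x - l) <=
      \sum_(x <- jordan_partition Y a) (x - l))%N.
  (* Adding the common multiplicity to both ranks makes [rankE] applicable; [n] then cancels. *)
  move=> e; rewrite -(leq_add2r (mup a (char_poly X))) {2}e.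
  by rewrite !rankE leq_add2l.
have rank_eq (a : R[i]) l :
    (\rank ((A - a%:M) ^+ l) == \rank ((B - a%:M) ^+ l)) =
    (\sum_(x <- jordan_partition A a) (x - l) ==
      \sum_(x <- jordan_partition B a) (x - l))%N.
  by rewrite !eqn_leq !rank_le.
split=> -[k [eq_lt le_k]]; exists k; split.
- by move=> l j /eq_lt eqj; apply/eqP; rewrite rank_eq eqj.
- move=> l; rewrite rank_le //; move: l.
  by apply/dominance_excess => //; exact: jordan_partition_sorted.
- move=> j jk; apply: partition_excess_inj;
    rewrite ?jordan_partition_sorted ?jordan_partition_gt0 //.
  by move=> l; apply/eqP; rewrite -rank_eq; apply/eqP/eq_lt.
- apply/dominance_excess; rewrite ?jordan_partition_sorted //.
  by move=> l; rewrite -rank_le.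
Qed.
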